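(* Let $G=(R\cup C,E)$ be a bipartite graph. (a) The smallest typical completion rank of $G$ is the generic completion rank of $G$. (b) If $r_1<r_2$ are typical completion ranks of $G$, then so is every integer $r$ such that $r_1\le r\le r_2$.
   Context: A bipartite graph $G=(R\cup C,E)$ is finite, with parts $R$ (of size $m$) and $C$ (of size $n$) and edge set $E\subseteq R\times C$. For a field $K$, a $G$-partial matrix over $K$ is a vector $M=(M_{ij})_{(i,j)\in E}\in K^E$. A completion of $M$ over $K$ is an $m\times n$ matrix $A$ with entries in $K$, rows indexed by $R$ and columns indexed by $C$, with $A_{ij}=M_{ij}$ for all $(i,j)\in E$. The $K$-completion rank of $M$ is the smallest rank of a completion of $M$ over $K$; for $K=\mathbb{R}$ (resp. $\mathbb{C}$) it is called the real (resp. complex) completion rank. The generic completion rank $\operatorname{gcr}(G)$ is the unique integer $r$ such that all $M$ in some nonempty Zariski-open subset of $\mathbb{C}^E$ have complex completion rank $r$. An integer $r$ is a typical completion rank of $G$ if the set of $M\in\mathbb{R}^E$ with real completion rank $r$ has nonempty interior in the Euclidean topology. *)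

(* Defs.v *)
From mathcomp Require Import all_boot all_order all_algebra.
From mathcomp Require Import complex.
From mathcomp Require Import boolp classical_sets reals topology normedtype.
(* [mpoly] is not imported: its notations clash with those of the analysis
   libraries. *)
From mathcomp Require mpoly.

Set Implicit Arguments.
Unset Strict Implicit.
Unset Printing Implicit Defensive.

Import Order.TTheory GRing.Theory Num.Theory.
Import numFieldNormedType.Exports.

Local Open Scope classical_set_scope.
Local Open Scope ring_scope.

(* A bipartite graph with parts of sizes m and n is given by its edge set
   [E : {set 'I_m * 'I_n}]. *)

(* K^E, with the coordinates listed along the enumeration of E: the coordinate
   of M at the edge [enum_val k] is [M 0 k]. *)
Definition partial_matrix (K : Type) m n (E : {set 'I_m * 'I_n}) : Type :=
  'rV[K]_#|E|.

Definition completion (K : Type) m n (E : {set 'I_m * 'I_n})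
    (M : partial_matrix K E) (A : 'M[K]_(m, n)) : Prop :=
  forall k : 'I_#|E|, A (enum_val k).1 (enum_val k).2 = M 0 k.

Lemma ex_completion_rank (K : fieldType) m n (E : {set 'I_m * 'I_n})
    (M : partial_matrix K E) :
  exists r, `[< exists2 A : 'M[K]_(m, n), completion M A & \rank A = r >].
Proof.
pose A : 'M[K]_(m, n) :=
  \matrix_(i, j) \sum_(k < #|E| | enum_val k == (i, j)) M 0 k.
exists (\rank A); apply/asboolP; exists A => // k.
rewrite mxE (big_pred1 k) // => l.
by rewrite -surjective_pairing (inj_eq enum_val_inj).
Qed.

Definition completion_rank (K : fieldType) m n (E : {set 'I_m * 'I_n})
    (M : partial_matrix K E) : nat :=
  ex_minn (ex_completion_rank M).

Definition zariski_open (K : comNzRingType) N (U : set 'rV[K]_N) : Prop :=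
  exists S : set (mpoly.mpoly N K),
    U = [set x : 'rV[K]_N | exists2 p, S p & mpoly.meval (x 0) p != 0].

Definition generic_completion_rank (R : realType) m n (E : {set 'I_m * 'I_n})
    (r : nat) : Prop :=
  exists U : set 'rV[R[i]]_#|E|,
    [/\ zariski_open U, U !=set0 &
        forall M : partial_matrix R[i] E, U M -> completion_rank M = r].

(* The topology on ['rV[R]_#|E|] is the product one, i.e. the Euclidean one. *)
Definition typical_completion_rank (R : realType) m n
    (E : {set 'I_m * 'I_n}) (r : nat) : Prop :=
  interior [set M : 'rV[R]_#|E| |
              completion_rank (M : partial_matrix R E) = r] !=set0.

(* Main.v *)
Require Import Defs.
From mathcomp Require Import all_boot all_order all_algebra.
From mathcomp Require Import closed_field ordered_qelim qe_rcf complex.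
From mathcomp Require Import boolp classical_sets.
From mathcomp Require Import reals topology normedtype realfun.
From mathcomp Require mpoly.

(** Partial matrices of completion rank at most [r] form the image of the
    polynomial map [f_r : (X, Y) |-> (XY)|_E], where [X] is [m x r] and [Y] is
    [r x n].  Everything follows from two forms of quantifier elimination for
    images of polynomial maps, and from the density of the complement of a
    proper hypersurface.

    Over the complex numbers an image is constructible.  Away from the zeros of
    one nonzero polynomial all atomic formulas of a quantifier-free definition
    have constant truth values, so membership in the image is constant there
    ([constant_image]).  Multiplying the polynomials obtained for [r <= m] gives
    a nonempty Zariski-open set on which the completion rank is constant: the
    generic completion rank [g] exists, and it is unique because two nonempty
    Zariski-open sets meet.

    Over the reals an image is semialgebraic.  Away from the zeros of a nonzero
    polynomial [q] the signs of all atoms are locally constant, hence so is the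
    real completion rank ([completion_rank_locally_constant]): a rank is typical
    as soon as it is reached at one point where [q] does not vanish.

    For [r >= g] no nonzero real polynomial [p] vanishes on the real image of
    [f_r]: otherwise [p o f_r] would be the zero function on real, hence on
    complex, points, and [p] would vanish on all complex partial matrices of
    rank [g] ([dominant_product]).  Taking [p = q] yields a real partial matrix
    of rank at most [g] around which the rank is constant; nearby there are
    points of rank at least [g], since the complex completion rank is at most
    the real one.  So [g] is typical, and the same comparison shows that every
    typical rank is at least [g].

    Intermediate ranks: the points with [q <> 0] are dense in the source of
    [f_r], so when [r + 1 > g] is not typical, the matrices of rank at most
    [r + 1] lie in the closure of those of rank at most [r].  A matrix of rank
    at most [k + 1] is the sum of one of rank at most [k] and one of rank at
    most [1]; by induction on [k] every partial matrix is then in the closure of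
    those of rank at most [r] ([atypical_closure]), and no rank above [r] is
    typical. *)

Set Implicit Arguments.
Unset Strict Implicit.
Unset Printing Implicit Defensive.

Import Order.TTheory GRing.Theory Num.Theory.
Import numFieldNormedType.Exports.
Import -(notations) mpoly.

Local Open Scope classical_set_scope.
Local Open Scope ring_scope.

Local Notation peval p v := (meval (fun_of_matrix v 0) p).

(** * Polynomials that do not vanish identically *)

(** Nonzero as a function rather than as a formal polynomial: the arguments only
    ever use values.  Over an infinite field the two notions agree. *)
Definition nonvanishing (K : nzRingType) n (p : mpoly n K) : Prop :=
  exists v : 'rV[K]_n, peval p v != 0.

Lemma nonvanishing1 (K : nzRingType) n : nonvanishing (1 : mpoly n K).
Proof. by exists 0; rewrite meval1 oner_neq0. Qed.

Lemma nonvanishingPn (K : nzRingType) n (p : mpoly n K) (v : 'rV_n) :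
  ~ nonvanishing p -> peval p v = 0.
Proof. by move=> p0; apply: contrapT => /eqP pv; apply: p0; exists v. Qed.

Lemma restrict_to_line (K : fieldType) n (p : mpoly n K) (z w : 'rV[K]_n) :
  exists u : {poly K}, forall t, u.[t] = peval p (z + t *: w).
Proof.
exists (mmap polyC (fun i => (z 0 i)%:P + (w 0 i) *: 'X) p) => t.
rewrite mevalE /mmap horner_sum; apply: eq_bigr => m _.
rewrite hornerM hornerC /mmap1 horner_prod; congr (_ * _).
by apply: eq_bigr => i _; rewrite horner_exp !hornerE !mxE mulrC.
Qed.

Lemma restrict_to_line_neq0 (K : fieldType) n (p : mpoly n K) (z w : 'rV[K]_n)
    (u : {poly K}) t :
  (forall s, u.[s] = peval p (z + s *: w)) -> peval p (z + t *: w) != 0 ->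
  u != 0.
Proof. by move=> uE; rewrite -uE; apply: contraNneq => ->; rewrite horner0. Qed.

Lemma poly_nonroot (K : fieldType) (u : {poly K}) (s : nat -> K) :
  injective s -> u != 0 -> exists k, u.[s k] != 0.
Proof.
move=> s_inj u0; apply: contrapT => noroot.
have := @max_poly_roots _ u [seq s k | k <- iota 0 (size u)] u0.
rewrite map_inj_uniq // iota_uniq size_map size_iota ltnn => H.
suff /H/(_ isT) : all (root u) [seq s k | k <- iota 0 (size u)] by [].
apply/allP => _ /mapP[k _ ->]; apply: contrapT => /negP ?.
by apply: noroot; exists k.
Qed.

(** On the line through a point where [p] is nonzero and a point where [q] is,
    both polynomials have finitely many zeros. *)
Lemma nonvanishingM (K : numFieldType) n (p q : mpoly n K) :
  nonvanishing p -> nonvanishing q -> nonvanishing (p * q).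
Proof.
move=> [z pz] [w qw].
have [u uE] := restrict_to_line p z (w - z).
have [v vE] := restrict_to_line q z (w - z).
have u0 : u != 0.
  by apply: (restrict_to_line_neq0 (t := 0) uE); rewrite scale0r addr0.
have v0 : v != 0.
  by apply: (restrict_to_line_neq0 (t := 1) vE); rewrite scale1r addrC subrK.
have natr_inj : injective (fun k => k%:R : K).
  by move=> a b /eqP; rewrite eqr_nat => /eqP.
have [k] := poly_nonroot natr_inj (mulf_neq0 u0 v0).
by rewrite hornerM uE vE => uv; exists (z + k%:R *: (w - z)); rewrite mevalM.
Qed.

Lemma nonvanishing_prod (K : numFieldType) n (I : finType) (p : I -> mpoly n K) :
  (forall i, nonvanishing (p i)) -> nonvanishing (\prod_i p i).
Proof.
move=> p0; apply: (big_ind (@nonvanishing K n)) => //.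
  exact: nonvanishing1.
exact: nonvanishingM.
Qed.

Lemma peval_prod_neq0 (K : fieldType) d (I : finType) (q : I -> mpoly d K)
    (v : 'rV_d) :
  peval (\prod_i q i) v != 0 -> forall i, peval (q i) v != 0.
Proof. by rewrite rmorph_prod => /prodf_neq0 h i; apply: h. Qed.

(** Starting from any point where [p] is nonzero, the coordinates are moved one
    at a time into the prescribed infinite sets, avoiding each time the finitely
    many zeros of [p] on a line parallel to an axis. *)
Lemma nonvanishing_box (K : fieldType) n (p : mpoly n K) (s : 'I_n -> nat -> K) :
  (forall i, injective (s i)) -> nonvanishing p ->
  exists g : 'I_n -> nat, peval p (\row_i s i (g i)) != 0.
Proof.
move=> s_inj [z0 pz0].
suff H k : (k <= n)%N -> exists2 z : 'rV[K]_n, peval p z != 0 &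
    forall i : 'I_n, (i < k)%N -> exists j, z 0 i = s i j.
  have [z pz zs] := H n (leqnn n).
  have /choice[g gE] : forall i, exists j, z 0 i = s i j.
    by move=> i; apply: zs.
  exists g; rewrite (_ : \row__ _ = z) //; apply/rowP => i.
  by rewrite mxE gE.
elim: k => [|k IH] kn; first by exists z0.
have [z pz zs] := IH (ltnW kn).
have [u uE] := restrict_to_line p z (delta_mx 0 (Ordinal kn)).
have u0 : u != 0.
  by apply: (restrict_to_line_neq0 (t := 0) uE); rewrite scale0r addr0.
have step_inj : injective (fun j => s (Ordinal kn) j - z 0 (Ordinal kn)).
  by move=> a b /addIr; apply: s_inj.
have [j] := poly_nonroot step_inj u0; rewrite uE => pz'.
eexists; first exact: pz'.
move=> i; rewrite ltnS leq_eqVlt => /predU1P[ik|ik].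
  have -> : i = Ordinal kn by apply: val_inj.
  by exists j; rewrite !mxE !eqxx mulr1 addrC subrK.
have [j' j'E] := zs _ ik; exists j'; rewrite !mxE eqxx /=.
suff -> : (i == Ordinal kn) = false by rewrite mulr0 addr0.
by apply/negbTE; rewrite -val_eqE /= neq_ltn ik.
Qed.

(** Nonempty Euclidean-open sets of real points are Zariski dense, also in the
    complex affine space: take [L] to be [R] or [R[i]]. *)
Lemma nonvanishing_near (R : realType) (L : fieldType) (f : {rmorphism R -> L})
    n (p : mpoly n L) (v : 'rV[R]_n) (A : set 'rV[R]_n) :
  nonvanishing p -> nbhs v A -> exists2 w, A w & peval p (map_mx f w) != 0.
Proof.
move=> p0 [P vP PA].
have /choice[e eP] : forall i, exists e : R, 0 < e /\ ball (v 0 i) e `<=` P 0 i.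
  by move=> i; have /nbhs_ballP[e e0 Pe] := vP 0 i; exists e.
(* The fractions e/2, e/3, ... are infinitely many steps shorter than e. *)
have [|g pg] :=
    nonvanishing_box (s := fun i k => f (v 0 i + e i / k.+2%:R)) _ p0.
  move=> i a b /fmorph_inj/addrI/mulfI H.
  have /H/invr_inj/eqP : e i != 0 by rewrite gt_eqF //; have [] := eP i.
  by rewrite eqr_nat eqSS => /eqP[].
exists (\row_i (v 0 i + e i / (g i).+2%:R)).
  apply: PA => i j; rewrite ord1 mxE; have [e0] := eP j; apply.
  rewrite /ball /= opprD addrA subrr sub0r normrN gtr0_norm ?divr_gt0 //.
  by rewrite ltr_pdivrMr // ltr_pMr // ltr1n.
by congr (_ != 0) : pg; apply: meval_eq => i; rewrite !mxE.
Qed.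

Lemma peval_map (K L : nzRingType) (f : {rmorphism K -> L}) n (p : mpoly n K)
    (v : 'rV[K]_n) :
  peval (map_mpoly f p) (map_mx f v) = f (peval p v).
Proof.
rewrite [in RHS]mevalE rmorph_sum [in LHS](mpolyE p) rmorph_sum /= raddf_sum.
apply: eq_bigr => m _ /=.
rewrite map_mpolyZ mevalZ map_mpolyX mevalX rmorphM rmorph_prod.
by congr (_ * _); apply: eq_bigr => i _; rewrite rmorphXn mxE.
Qed.

(** * Images of polynomial maps as first-order definable sets *)

Definition poly_map (K : nzRingType) d n (f : n.-tuple (mpoly d K))
    (x : 'rV[K]_d) : 'rV[K]_n :=
  \row_k peval (tnth f k) x.

Definition env (K : nzRingType) n (v : 'rV[K]_n) : seq K :=
  [seq v 0 i | i <- enum 'I_n].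

Lemma size_env (K : nzRingType) n (v : 'rV[K]_n) : size (env v) = n.
Proof. by rewrite size_map size_enum_ord. Qed.

Lemma nth_env (K : nzRingType) n (v : 'rV[K]_n) (i : 'I_n) : (env v)`_i = v 0 i.
Proof. by rewrite (nth_map i) ?size_enum_ord // nth_ord_enum. Qed.

(** Variables beyond the first [n] become [0], the default value they have in
    an environment of size [n]. *)
Fixpoint poly_of_term (K : comUnitRingType) n (t : GRing.term K) : mpoly n K :=
  match t with
  | GRing.Var i => if insub i is Some j then mpolyX K (mnm1 j) else 0
  | GRing.Const c => mpolyC n c
  | GRing.NatConst k => k%:R
  | GRing.Add t1 t2 => poly_of_term n t1 + poly_of_term n t2
  | GRing.Opp t1 => - poly_of_term n t1
  | GRing.NatMul t1 k => poly_of_term n t1 *+ k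
  | GRing.Mul t1 t2 => poly_of_term n t1 * poly_of_term n t2
  | GRing.Inv _ => 0
  | GRing.Exp t1 k => poly_of_term n t1 ^+ k
  end.

Lemma peval_poly_of_term (K : comUnitRingType) n (t : GRing.term K)
    (v : 'rV[K]_n) :
  GRing.rterm t -> peval (poly_of_term n t) v = GRing.eval (env v) t.
Proof.
elim: t => //=.
- move=> i _; case: insubP => [j _ <-|]; first by rewrite mevalXU nth_env.
  by rewrite -leqNgt => ni; rewrite meval0 nth_default ?size_env.
- by move=> c _; rewrite mevalC.
- by move=> k _; rewrite rmorph_nat.
- by move=> t1 IH1 t2 IH2 /andP[/IH1 <- /IH2 <-]; rewrite mevalD.
- by move=> t IH /IH <-; rewrite mevalN.
- by move=> t IH k /IH <-; rewrite mevalMn.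
- by move=> t1 IH1 t2 IH2 /andP[/IH1 <- /IH2 <-]; rewrite mevalM.
- by move=> t IH k /IH <-; rewrite rmorphXn.
Qed.

(** The variables are shifted by [n], to make room for the [n] coordinates of a
    point of the target of a polynomial map. *)
Definition term_of_poly (K : comUnitRingType) n d (p : mpoly d K) :
    GRing.term K :=
  \big[@GRing.Add K/GRing.NatConst K 0]_(m <- msupp p)
    GRing.Mul (GRing.Const (mcoeff m p))
      (\big[@GRing.Mul K/GRing.NatConst K 1]_(i < d)
         GRing.Exp (GRing.Var K (n + i)) (m i)).

Lemma rterm_term_of_poly (K : comUnitRingType) n d (p : mpoly d K) :
  GRing.rterm (term_of_poly n p).
Proof.
apply: (big_ind (@GRing.rterm K)) => //= [? ? -> ->//|m _].
by apply: (big_ind (@GRing.rterm K)) => //= ? ? -> ->.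
Qed.

Lemma eval_term_of_poly (K : comUnitRingType) n d (p : mpoly d K) (e : seq K) :
  GRing.eval e (term_of_poly n p) = meval (fun i => e`_(n + i)) p.
Proof.
rewrite mevalE (@big_morph _ _ (GRing.eval e) 0 +%R) //; apply: eq_bigr => m _ /=.
by congr (_ * _); rewrite (@big_morph _ _ (GRing.eval e) 1 *%R).
Qed.

Definition image_formula (K : comUnitRingType) d n (f : n.-tuple (mpoly d K)) :
    GRing.formula K :=
  foldr (@GRing.Exists K)
    (\big[@GRing.And K/GRing.Bool true]_(k < n)
       GRing.Equal (GRing.Var K k) (term_of_poly n (tnth f k)))
    (iota n d).

Lemma rformula_image (K : comUnitRingType) d n (f : n.-tuple (mpoly d K)) :
  GRing.rformula (image_formula f).
Proof.
rewrite /image_formula; elim: iota => //=.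
apply: (big_ind (@GRing.rformula K)) => //= [? ? -> ->//|k _].
exact: rterm_term_of_poly.
Qed.

Lemma holds_bigAnd (K : unitRingType) (I : finType) (F : I -> GRing.formula K)
    (e : seq K) :
  GRing.holds e (\big[@GRing.And K/GRing.Bool true]_i F i) <->
  forall i, GRing.holds e (F i).
Proof.
suff H (r : seq I) :
    GRing.holds e (\big[@GRing.And K/GRing.Bool true]_(i <- r) F i) <->
    forall i, i \in r -> GRing.holds e (F i).
  by rewrite H; split=> [h i|h i _] //; apply: h; exact: mem_index_enum.
elim: r => [|i r IH]; first by rewrite big_nil.
rewrite big_cons /= IH; split=> [[hi hr] j|h].
  by rewrite inE => /predU1P[->|/hr].
by split=> [|j jr]; apply: h; rewrite inE ?eqxx ?jr ?orbT.
Qed.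

Lemma holds_image (K : comUnitRingType) d n (f : n.-tuple (mpoly d K))
    (v : 'rV[K]_n) :
  GRing.holds (env v) (image_formula f) <-> range (poly_map f) v.
Proof.
rewrite -GRing.foldExistsP; split.
- move=> [e eqe /holds_bigAnd he]; exists (\row_i e`_(n + i)) => //.
  apply/rowP => k; rewrite mxE.
  have /= := he k; rewrite -eqe ?nth_env => [->|]; last first.
    by rewrite !inE mem_iota /= leqNgt ltn_ord.
  by rewrite eval_term_of_poly; apply: meval_eq => i; rewrite mxE.
- move=> [x _ <-]; exists (env (row_mx (poly_map f x) x)).
    move=> i; rewrite !inE mem_iota.
    have [ni|ni] := ltnP i n; move=> /=.
      have -> : (env (poly_map f x))`_i = poly_map f x 0 (Ordinal ni).
        exact: (nth_env _ (Ordinal ni)).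
      by rewrite -(row_mxEl _ x) -nth_env.
    by rewrite -leqNgt => ndi; rewrite !nth_default ?size_env.
  apply/holds_bigAnd => k /=.
  have /= -> := nth_env (row_mx (poly_map f x) x) (lshift d k).
  rewrite row_mxEl eval_term_of_poly mxE; apply: meval_eq => i.
  have /= -> := nth_env (row_mx (poly_map f x) x) (rshift n i).
  by rewrite row_mxEr.
Qed.

(** * Constructible images are generically constant *)

Definition constant_off (K : nzRingType) n T (q : mpoly n K)
    (F : 'rV[K]_n -> T) : Prop :=
  forall v w, peval q v != 0 -> peval q w != 0 -> F v = F w.

Lemma constant_off_op (K : idomainType) n T1 T2 T (op : T1 -> T2 -> T)
    (q1 q2 : mpoly n K) F1 F2 :
  constant_off q1 F1 -> constant_off q2 F2 ->
  constant_off (q1 * q2) (fun v => op (F1 v) (F2 v)).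
Proof.
move=> H1 H2 v w; rewrite !mevalM !mulf_eq0 !negb_or => /andP[v1 v2] /andP[w1 w2].
by rewrite (H1 v w) // (H2 v w).
Qed.

(** An atom [t1 = t2] whose polynomial [t1 - t2] is not identically zero is false
    off its zeros, and the other atoms are always true. *)
Lemma constant_qf_eval (K : numClosedFieldType) n (f : GRing.formula K) :
  GRing.qf_form f && GRing.rformula f ->
  exists2 q : mpoly n K, nonvanishing q &
    constant_off q (fun v => GRing.qf_eval (env v) f).
Proof.
have both op (f1 f2 : GRing.formula K) (q1 q2 : mpoly n K) :
    nonvanishing q1 -> nonvanishing q2 ->
    constant_off q1 (fun v => GRing.qf_eval (env v) f1) ->
    constant_off q2 (fun v => GRing.qf_eval (env v) f2) ->
    exists2 q : mpoly n K, nonvanishing q & constant_off q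
      (fun v => op (GRing.qf_eval (env v) f1) (GRing.qf_eval (env v) f2) : bool).
  move=> q10 q20 H1 H2; exists (q1 * q2); first exact: nonvanishingM.
  exact: constant_off_op H1 H2.
elim: f => //=.
- by move=> b _; exists 1; first exact: nonvanishing1.
- move=> t1 t2 /andP[r1 r2].
  pose p := poly_of_term n t1 - poly_of_term n t2.
  have pE (v : 'rV_n) :
      (GRing.eval (env v) t1 == GRing.eval (env v) t2) = (peval p v == 0).
    by rewrite mevalB !peval_poly_of_term // subr_eq0.
  have [p0|p0] := pselect (nonvanishing p).
    by exists p => // v w; rewrite !pE => /negbTE -> /negbTE ->.
  exists 1; first exact: nonvanishing1.
  by move=> v w _ _; rewrite !pE !nonvanishingPn.
- move=> f1 IH1 f2 IH2; rewrite andbACA => /andP[/IH1[q1 q10 H1] /IH2[q2 q20 H2]].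
  exact: (both andb _ _ q1 q2).
- move=> f1 IH1 f2 IH2; rewrite andbACA => /andP[/IH1[q1 q10 H1] /IH2[q2 q20 H2]].
  exact: (both orb _ _ q1 q2).
- move=> f1 IH1 f2 IH2; rewrite andbACA => /andP[/IH1[q1 q10 H1] /IH2[q2 q20 H2]].
  exact: (both implb _ _ q1 q2).
- by move=> f1 IH1 /IH1[q q0 H]; exact: (both (fun b _ => ~~ b) _ f1 q q).
Qed.

(** The consequence of Chevalley's theorem needed here: quantifier elimination
    over an algebraically closed field makes the image constructible, so a dense
    open set either lies in it or misses it. *)
Lemma constant_image (K : numClosedFieldType) d n (f : n.-tuple (mpoly d K)) :
  exists2 q : mpoly n K, nonvanishing q & constant_off q (range (poly_map f)).
Proof.
have wf := @ClosedFieldQE.wf_ex_elim K.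
have ok := ClosedFieldQE.holds_ex_elim (@solve_monicpoly K).
have rf := rformula_image f.
have P (v : 'rV_n) := rwP (GRing.quantifier_elim_rformP wf ok (env v) rf).
have [q q0 H] := constant_qf_eval n (GRing.quantifier_elim_wf wf rf).
exists q => // v w qv qw; apply/propext.
by rewrite -!holds_image !P (H v w).
Qed.

(** * Semialgebraic images are generically locally constant *)

Fixpoint oformula (K : Type) (f : GRing.formula K) : ord.formula K :=
  match f with
  | GRing.Bool b => ord.Bool b
  | GRing.Equal t1 t2 => ord.Equal t1 t2
  | GRing.Unit t => ord.Unit t
  | GRing.And f1 f2 => ord.And (oformula f1) (oformula f2)
  | GRing.Or f1 f2 => ord.Or (oformula f1) (oformula f2)
  | GRing.Implies f1 f2 => ord.Implies (oformula f1) (oformula f2)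
  | GRing.Not f1 => ord.Not (oformula f1)
  | GRing.Exists i f1 => ord.Exists i (oformula f1)
  | GRing.Forall i f1 => ord.Forall i (oformula f1)
  end.

Lemma holds_oformula (K : realDomainType) (f : GRing.formula K) e :
  ord.holds e (oformula f) <-> GRing.holds e f.
Proof.
elim: f e => //=.
- by move=> f1 IH1 f2 IH2 e; rewrite IH1 IH2.
- by move=> f1 IH1 f2 IH2 e; rewrite IH1 IH2.
- by move=> f1 IH1 f2 IH2 e; rewrite IH1 IH2.
- by move=> f1 IH1 e; rewrite IH1.
- by move=> i f1 IH1 e; split=> -[x]; exists x; apply/IH1.
- by move=> i f1 IH1 e; split=> h x; apply/IH1.
Qed.

Lemma rformula_oformula (K : realDomainType) (f : GRing.formula K) :
  ord.rformula (oformula f) = GRing.rformula f.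
Proof. by elim: f => //= f1 -> f2 ->. Qed.

Lemma continuous_peval (R : realType) n (p : mpoly n R) :
  continuous (fun v : 'rV[R]_n => peval p v).
Proof.
pose monomial m (v : 'rV[R]_n) := \prod_i v 0 i ^+ m i.
have monomial_cont m : continuous (monomial m).
  apply: (@continuous_big R _ *%R 1 xpredT _ _ _
    (fun i (v : 'rV[R]_n) => v 0 i ^+ m i)).
    exact: mul_continuous.
  move=> i _ v.
  apply: (@continuous_comp _ _ _ (fun v : 'rV[R]_n => v 0 i) (fun x => x ^+ m i)).
    exact: coord_continuous.
  exact: exprn_continuous.
apply: (@continuous_big R _ +%R 0 xpredT _ _ _
  (fun m (v : 'rV[R]_n) => mcoeff m p * monomial m v)).
  exact: add_continuous.
move=> m _ v; apply: continuousM; first exact: cst_continuous.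
exact: monomial_cont.
Qed.

Lemma continuous_poly_map (R : realType) d n (f : n.-tuple (mpoly d R)) :
  continuous (poly_map f).
Proof.
move=> x A [P xP PA].
suff: \forall y \near x, A (poly_map f y) by [].
near=> y.
apply: PA => i j; rewrite ord1 mxE; move: j; near: y; apply: filter_forall => j.
by have := xP 0 j; rewrite mxE; apply: continuous_peval.
Unshelve. all: by end_near. Qed.

Definition locally_constant_off (R : realType) n T (q : mpoly n R)
    (F : 'rV[R]_n -> T) : Prop :=
  forall v, peval q v != 0 -> \forall w \near v, F w = F v.

Lemma locally_constant_off_op (R : realType) n T1 T2 T (op : T1 -> T2 -> T)
    (q1 q2 : mpoly n R) F1 F2 :
  locally_constant_off q1 F1 -> locally_constant_off q2 F2 ->
  locally_constant_off (q1 * q2) (fun v => op (F1 v) (F2 v)).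
Proof.
move=> H1 H2 v; rewrite mevalM mulf_eq0 negb_or => /andP[/H1 v1 /H2 v2].
by near do congr op.
Unshelve. all: by end_near. Qed.

Lemma locally_constant_sg (R : realType) n (p : mpoly n R) :
  exists2 q : mpoly n R, nonvanishing q &
    locally_constant_off q (fun v => Num.sg (peval p v)).
Proof.
have [p0|p0] := pselect (nonvanishing p); last first.
  exists 1; first exact: nonvanishing1.
  by move=> v _; near=> w; rewrite !nonvanishingPn.
exists p => // v pv; near=> w.
have : 0 < peval p w * peval p v; last first.
  case: (sgrP (peval p w)) => [->|wp|wn]; first by rewrite mul0r ltxx.
    by rewrite pmulr_rgt0 // => /gtr0_sg.
  by rewrite nmulr_rgt0 // => /ltr0_sg.
near: w.
apply: (@cvgr_gt _ _ _ _ (fun w => peval p w * peval p v)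
  (peval p v * peval p v)).
  by apply: cvgMl; apply: continuous_peval.
by rewrite -expr2 exprn_even_gt0.
Unshelve. all: by end_near. Qed.

(** The truth value of each atom is a function of the sign of the difference of
    its two sides. *)
Lemma locally_constant_qf_eval (R : realType) n (f : ord.formula R) :
  ord.qf_form f && ord.rformula f ->
  exists2 q : mpoly n R, nonvanishing q &
    locally_constant_off q (fun v => ord.qf_eval (env v) f).
Proof.
have both op (f1 f2 : ord.formula R) (q1 q2 : mpoly n R) :
    nonvanishing q1 -> nonvanishing q2 ->
    locally_constant_off q1 (fun v => ord.qf_eval (env v) f1) ->
    locally_constant_off q2 (fun v => ord.qf_eval (env v) f2) ->
    exists2 q : mpoly n R, nonvanishing q & locally_constant_off q
      (fun v => op (ord.qf_eval (env v) f1) (ord.qf_eval (env v) f2) : bool).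
  move=> q10 q20 H1 H2; exists (q1 * q2); first exact: nonvanishingM.
  exact: locally_constant_off_op H1 H2.
have atom (c : R -> bool) (t1 t2 : GRing.term R) :
    GRing.rterm t1 && GRing.rterm t2 ->
    exists2 q : mpoly n R, nonvanishing q & locally_constant_off q (fun v =>
      c (Num.sg (GRing.eval (env v) t1 - GRing.eval (env v) t2))).
  move=> /andP[r1 r2].
  have [q q0 H] := locally_constant_sg (poly_of_term n t1 - poly_of_term n t2).
  exists q => // v /H; apply: filterS => w.
  by rewrite !mevalB !peval_poly_of_term // => ->.
elim: f => //=.
- move=> b _; exists 1; first exact: nonvanishing1.
  by move=> v _; near=> w.
- move=> t1 t2 /(atom (fun x => x == 0))[q q0 H]; exists q => // v /H.
  by apply: filterS => w; rewrite !sgr_eq0 !subr_eq0.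
- move=> t1 t2 /(atom (fun x => x < 0))[q q0 H]; exists q => // v /H.
  by apply: filterS => w; rewrite !sgr_lt0 !subr_lt0.
- move=> t1 t2 /(atom (fun x => x <= 0))[q q0 H]; exists q => // v /H.
  by apply: filterS => w; rewrite !sgr_le0 !subr_le0.
- move=> f1 IH1 f2 IH2; rewrite andbACA => /andP[/IH1[q1 q10 H1] /IH2[q2 q20 H2]].
  exact: (both andb _ _ q1 q2).
- move=> f1 IH1 f2 IH2; rewrite andbACA => /andP[/IH1[q1 q10 H1] /IH2[q2 q20 H2]].
  exact: (both orb _ _ q1 q2).
- move=> f1 IH1 f2 IH2; rewrite andbACA => /andP[/IH1[q1 q10 H1] /IH2[q2 q20 H2]].
  exact: (both implb _ _ q1 q2).
- by move=> f1 IH1 /IH1[q q0 H]; exact: (both (fun b _ => ~~ b) _ f1 q q).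
Unshelve. all: by end_near. Qed.

(** The real counterpart of [constant_image], from the Tarski-Seidenberg
    theorem.  Only local constancy survives: the image of [x |-> x ^ 2] contains
    one of the two open half lines where [q = 'X] is nonzero. *)
Lemma locally_constant_image (R : realType) d n (f : n.-tuple (mpoly d R)) :
  exists2 q : mpoly n R, nonvanishing q &
    locally_constant_off q (range (poly_map f)).
Proof.
have wf := @wf_QE_wproj R.
have ok := @valid_QE_wproj R.
have rf : ord.rformula (oformula (image_formula f)).
  by rewrite rformula_oformula rformula_image.
have P (v : 'rV_n) := rwP (ord.quantifier_elim_rformP wf ok (env v) rf).
have [q q0 H] := locally_constant_qf_eval n (ord.quantifier_elim_wf wf rf).
exists q => // v /H; apply: filterS => w vw; apply/propext.
by rewrite -!holds_image -!holds_oformula !P vw.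
Qed.

(** * Completion ranks *)

Lemma nbhs_translate (R : realType) n (v w : 'rV[R]_n) A :
  nbhs (v + w) A -> nbhs v [set u | nbhs (u + w) A].
Proof.
move=> [P vwP PA]; exists (fun i j => [set x | nbhs (x + w i j) (P i j)]).
  move=> i j; have := vwP i j; rewrite mxE => /nbhs_interior vwP'.
  have shift : x + w i j @[x --> v i j] --> v i j + w i j.
    by apply: cvgD; [exact: cvg_id|exact: cvg_cst].
  exact: (shift _ vwP').
by move=> u uP; exists P => // i j; rewrite mxE; apply: uP.
Qed.

Lemma rank_factor (K : fieldType) m n r (A : 'M[K]_(m, n)) :
  (\rank A <= r)%N -> exists (X : 'M_(m, r)) (Y : 'M_(r, n)), A = X *m Y.
Proof.
move=> Ar.
exists (col_ebase A *m pid_mx (\rank A)), (pid_mx (\rank A) *m row_ebase A).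
rewrite -[LHS]mulmx_ebase !mulmxA; congr (_ *m _).
by rewrite -[RHS]mulmxA mul_pid_mx minnn (minn_idPr Ar).
Qed.

Section CompletionRank.
Variables (m n : nat) (E : {set 'I_m * 'I_n}).

Definition restrict (K : Type) (A : 'M[K]_(m, n)) : partial_matrix K E :=
  \row_k A (enum_val k).1 (enum_val k).2.

Lemma completionE (K : Type) (M : partial_matrix K E) A :
  completion M A <-> restrict A = M.
Proof.
split=> [MA|<- k]; last by rewrite mxE.
by apply/rowP => k; rewrite mxE MA.
Qed.

Lemma completion_rank_le (K : fieldType) (M : partial_matrix K E) r :
  (completion_rank M <= r)%N <-> exists2 A, restrict A = M & (\rank A <= r)%N.
Proof.
rewrite /completion_rank; case: ex_minnP => k /asboolP[A /completionE MA <-] kmin.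
split=> [Ar|[B MB Br]]; first by exists A.
apply: leq_trans Br; apply: kmin; apply/asboolP; exists B => //.
exact/completionE.
Qed.

Lemma completion_rank_le_rows (K : fieldType) (M : partial_matrix K E) :
  (completion_rank M <= m)%N.
Proof.
have [A MA _] := (completion_rank_le M _).1 (leqnn _).
by apply/completion_rank_le; exists A => //; apply: rank_leq_row.
Qed.

Lemma completion_rank_split (K : fieldType) (M : partial_matrix K E) a b :
  (completion_rank M <= a + b)%N <->
  exists M1 M2 : partial_matrix K E,
  [/\ M = M1 + M2, (completion_rank M1 <= a)%N & (completion_rank M2 <= b)%N].
Proof.
split.
  move=> /completion_rank_le[A <- /rank_factor[X [Y ->]]].
  exists (restrict (lsubmx X *m usubmx Y)), (restrict (rsubmx X *m dsubmx Y)).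
  split.
  - rewrite -{1}[X]hsubmxK -{1}[Y]vsubmxK mul_row_col.
    by apply/rowP => k; rewrite !mxE.
  - apply/completion_rank_le; eexists; first by [].
    by rewrite (leq_trans (mxrankM_maxl _ _)) // rank_leq_col.
  - apply/completion_rank_le; eexists; first by [].
    by rewrite (leq_trans (mxrankM_maxl _ _)) // rank_leq_col.
move=> [M1 [M2 [-> /completion_rank_le[A1 <- r1] /completion_rank_le[A2 <- r2]]]].
apply/completion_rank_le; exists (A1 + A2).
  by apply/rowP => k; rewrite !mxE.
by rewrite (leq_trans (mxrank_add _ _)) // leq_add.
Qed.

Lemma completion_rank_map (K L : fieldType) (f : {rmorphism K -> L})
    (M : partial_matrix K E) :
  (completion_rank (map_mx f M : partial_matrix L E) <= completion_rank M)%N.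
Proof.
have [A MA Ar] := (completion_rank_le M _).1 (leqnn _).
apply/completion_rank_le; exists (map_mx f A); last by rewrite mxrank_map.
by rewrite -MA; apply/rowP => k; rewrite !mxE.
Qed.

(** The map [(X, Y) |-> (XY)|_E]; the variables are the entries of [X] followed
    by those of [Y], so that a point is [row_mx (mxvec X) (mxvec Y)]. *)
Definition product_polys (K : nzRingType) r :
    #|E|.-tuple (mpoly (m * r + r * n) K) :=
  [tuple \sum_(l < r)
     mpolyX K (mnm1 (lshift (r * n) (mxvec_index (enum_val k).1 l))) *
     mpolyX K (mnm1 (rshift (m * r) (mxvec_index l (enum_val k).2)))
   | k < #|E|].

Lemma poly_map_product (K : comNzRingType) r (X : 'M[K]_(m, r)) (Y : 'M_(r, n)) :
  poly_map (product_polys K r) (row_mx (mxvec X) (mxvec Y)) = restrict (X *m Y).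
Proof.
apply/rowP => k; rewrite !mxE tnth_mktuple rmorph_sum; apply: eq_bigr => l _.
by rewrite /= mevalM !mevalXU row_mxEl row_mxEr !mxvecE.
Qed.

Lemma completion_rank_image (K : fieldType) r :
  [set M : partial_matrix K E | (completion_rank M <= r)%N] =
  range (poly_map (product_polys K r)).
Proof.
apply/seteqP; split=> M /=.
  move=> /completion_rank_le[A <- /rank_factor[X [Y ->]]].
  by exists (row_mx (mxvec X) (mxvec Y)) => //; rewrite poly_map_product.
move=> [x _ <-].
rewrite -[x]hsubmxK -[lsubmx x]vec_mxK -[rsubmx x]vec_mxK poly_map_product.
apply/completion_rank_le; eexists; first by [].
by rewrite (leq_trans (mxrankM_maxl _ _)) // rank_leq_col.
Qed.

Lemma poly_map_product_map (K L : fieldType) (f : {rmorphism K -> L}) r x :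
  poly_map (product_polys L r) (map_mx f x) =
  map_mx f (poly_map (product_polys K r) x).
Proof.
rewrite -[x]hsubmxK -[lsubmx x]vec_mxK -[rsubmx x]vec_mxK.
rewrite map_row_mx !map_mxvec !poly_map_product -map_mxM.
by apply/rowP => k; rewrite !mxE.
Qed.

Lemma eq_completion_rank (K : fieldType) (M M' : partial_matrix K E) :
  (forall r : 'I_m.+1,
     (completion_rank M <= r)%N = (completion_rank M' <= r)%N) ->
  completion_rank M = completion_rank M'.
Proof.
move=> eqr; have lt (N : partial_matrix K E) : (completion_rank N < m.+1)%N.
  exact: completion_rank_le_rows.
apply/eqP; rewrite eqn_leq.
by rewrite (eqr (Ordinal (lt M'))) -(eqr (Ordinal (lt M))) /= !leqnn.
Qed.

Lemma completion_rank_constant (K : numClosedFieldType) :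
  exists2 q : mpoly #|E| K, nonvanishing q &
    constant_off q (fun M => completion_rank (M : partial_matrix K E)).
Proof.
have /choice[q qP] : forall r : 'I_m.+1, exists q : mpoly #|E| K,
    nonvanishing q /\ constant_off q
      (fun M => completion_rank (M : partial_matrix K E) <= r)%N.
  move=> r; have [q q0 H] := constant_image (product_polys K r).
  exists q; split=> // v w qv qw.
  have := H v w qv qw; rewrite -completion_rank_image /= => vw.
  by apply/idP/idP; rewrite vw.
exists (\prod_r q r); first by apply: nonvanishing_prod => r; have [] := qP r.
move=> v w /peval_prod_neq0 qv /peval_prod_neq0 qw.
by apply: eq_completion_rank => r; have [_] := qP r; apply.
Qed.

Lemma completion_rank_locally_constant (R : realType) :
  exists2 q : mpoly #|E| R, nonvanishing q &
    locally_constant_off q (fun M => completion_rank (M : partial_matrix R E)).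
Proof.
have /choice[q qP] : forall r : 'I_m.+1, exists q : mpoly #|E| R,
    nonvanishing q /\ locally_constant_off q
      (fun M => completion_rank (M : partial_matrix R E) <= r)%N.
  move=> r; have [q q0 H] := locally_constant_image (product_polys R r).
  exists q; split=> // v /H; apply: filterS => w.
  by rewrite -completion_rank_image /= => vw; apply/idP/idP; rewrite vw.
exists (\prod_r q r); first by apply: nonvanishing_prod => r; have [] := qP r.
move=> v /peval_prod_neq0 qv; near=> w; apply: eq_completion_rank.
near: w; apply: filter_forall => r; have [_] := qP r; exact.
Unshelve. all: by end_near. Qed.

Lemma generic_completion_rankP (R : realType) g :
  generic_completion_rank R E g <->
  exists2 q : mpoly #|E| R[i], nonvanishing q &
    forall M : partial_matrix R[i] E, peval q M != 0 -> completion_rank M = g.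
Proof.
split=> [[U [[S ->] [v [q Sq qv]] UM]]|[q [v qv] qM]].
  by exists q; [exists v|move=> M qM; apply: UM; exists q].
exists [set M | peval q M != 0]; split=> //; last by exists v.
exists [set q]; apply/seteqP; split=> M /= => [qM'|[_ ->]//].
by exists q.
Qed.

(** * Typical ranks compared with the generic rank *)

Section TypicalRanks.
Variables (R : realType) (g : nat).
Hypothesis g_gen : generic_completion_rank R E g.

Let rk (M : 'rV[R]_#|E|) := completion_rank (M : partial_matrix R E).

Lemma generic_le_near (M : 'rV[R]_#|E|) A :
  nbhs M A -> exists2 M', A M' & (g <= rk M')%N.
Proof.
have [q q0 qg] := (generic_completion_rankP _ _).1 g_gen.
move=> /(nonvanishing_near (real_complex R) q0)[M' AM' qM']; exists M' => //.
by rewrite -(qg _ qM'); apply: completion_rank_map.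
Qed.

(** For [r >= g] the real map [f_r] is dominant.  Over the complex numbers the
    image contains the nonempty Zariski-open set of matrices of rank [g]; this
    passes to the reals because the real points are Zariski dense in the complex
    source of [f_r]. *)
Lemma dominant_product (p : mpoly #|E| R) r : nonvanishing p -> (g <= r)%N ->
  nonvanishing (comp_mpoly (product_polys R r) p).
Proof.
move=> [v pv] gr.
have [q q0 qg] := (generic_completion_rankP _ _).1 g_gen.
pose f := real_complex R.
have pf0 : nonvanishing (map_mpoly f p).
  by exists (map_mx f v); rewrite peval_map fmorph_eq0.
have [M] := nonvanishingM pf0 q0.
rewrite mevalM mulf_eq0 negb_or => /andP[pM /qg Mg].
have : [set M : partial_matrix R[i] E | (completion_rank M <= r)%N] M.
  by rewrite /= Mg.
rewrite completion_rank_image => -[x _ xM].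
have F0 : nonvanishing (comp_mpoly (product_polys R[i] r) (map_mpoly f p)).
  exists x; rewrite comp_mpoly_meval; congr (_ != 0) : pM.
  by apply: meval_eq => k; rewrite -xM mxE.
have [y _] := nonvanishing_near f (v := 0) F0 filterT.
rewrite comp_mpoly_meval => Fy; exists y; rewrite comp_mpoly_meval.
apply: contraNneq Fy => py.
have := peval_map f p (poly_map (product_polys R r) y).
rewrite -poly_map_product_map.
have -> : peval p (poly_map (product_polys R r) y) = 0.
  by rewrite -py; apply: meval_eq => k; rewrite mxE.
by rewrite rmorph0 => <-; apply/eqP/meval_eq => k; rewrite mxE.
Qed.

(** The perturbation takes place in the source of [f_r], where the composite of
    [p] with [f_r] is nonzero on a dense set, so the rank bound is kept. *)
Lemma completion_rank_dense (p : mpoly #|E| R) r M A :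
  nonvanishing p -> (g <= r)%N -> (rk M <= r)%N -> nbhs M A ->
  exists M', [/\ A M', (rk M' <= r)%N & peval p M' != 0].
Proof.
move=> p0 gr Mr MA.
have : [set M : partial_matrix R E | (completion_rank M <= r)%N] M by [].
rewrite completion_rank_image => -[x _ xM].
have xA : nbhs x (poly_map (product_polys R r) @^-1` A).
  by apply: continuous_poly_map; rewrite xM.
have [y Ay] := nonvanishing_near idfun (dominant_product p0 gr) xA.
rewrite comp_mpoly_meval => py.
exists (poly_map (product_polys R r) y); split=> //.
  have : range (poly_map (product_polys R r)) (poly_map (product_polys R r) y).
    by exists y.
  by rewrite -completion_rank_image.
congr (_ != 0) : py; apply: meval_eq => k; rewrite mxE.
by apply: meval_eq => i; rewrite mxE.
Qed.

Lemma completion_rank0 : rk 0 = 0%N.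
Proof.
apply/eqP; rewrite -leqn0; apply/completion_rank_le.
by exists 0; [apply/rowP => k; rewrite !mxE | rewrite mxrank0].
Qed.

Lemma typical_at (q : mpoly #|E| R) M :
  locally_constant_off q rk -> peval q M != 0 ->
  typical_completion_rank R E (rk M).
Proof. by move=> qloc qM; exists M; exact: qloc qM. Qed.

Lemma typical_generic : typical_completion_rank R E g.
Proof.
have [q q0 qloc] := completion_rank_locally_constant R.
have [||M [_ Mg qM]] :=
  completion_rank_dense (r := g) (M := 0) q0 _ _ filterT => //.
  by rewrite completion_rank0.
have [M' M'M gM'] := generic_le_near (qloc M qM).
have <- : rk M = g by apply/eqP; rewrite eqn_leq Mg -[rk M]M'M.
exact: typical_at qM.
Qed.

Lemma generic_le_typical r : typical_completion_rank R E r -> (g <= r)%N.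
Proof. by move=> [M /generic_le_near[M' <-]]. Qed.

(** If [r + 1] is not typical, a matrix of rank at most [r + 1] can be moved
    slightly to where the rank is locally constant, and there the rank is at most
    [r].  Writing a matrix of larger rank as [M1 + M2] with [M2] of rank at most
    [1], the induction replaces [M1] by a nearby [N] of rank at most [r]; then
    [N + M2] has rank at most [r + 1], and is in turn near one of rank at most
    [r]. *)
Lemma atypical_closure r k (M : 'rV[R]_#|E|) A : (g <= r)%N ->
  ~ typical_completion_rank R E r.+1 ->
  (rk M <= r.+1 + k)%N -> nbhs M A -> exists2 M', A M' & (rk M' <= r)%N.
Proof.
move=> gr atyp.
have [q q0 qloc] := completion_rank_locally_constant R.
have step N B :
    (rk N <= r.+1)%N -> nbhs N B -> exists2 N', B N' & (rk N' <= r)%N.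
  move=> Nr NB.
  have [N' [BN' N'r qN']] := completion_rank_dense q0 (leqW gr) Nr NB.
  exists N' => //; rewrite -ltnS ltn_neqAle N'r andbT; apply/negP => /eqP N'E.
  by apply: atyp; rewrite -N'E; apply: typical_at qN'.
elim: k M A => [|k IH] M A; first by rewrite addn0; apply: step.
rewrite addnS -addn1 => /completion_rank_split[M1 [M2 [-> M1r M2r]]] MA.
have [N NA Nr] := IH M1 _ M1r (nbhs_translate MA).
apply: step NA; rewrite /rk -[r.+1]addn1; apply/completion_rank_split.
by exists N, M2.
Qed.

Lemma typical_interval r1 r2 r :
  typical_completion_rank R E r1 -> typical_completion_rank R E r2 ->
  (r1 <= r <= r2)%N -> typical_completion_rank R E r.
Proof.
move=> typ1 [M2 M2r] /andP[]; rewrite leq_eqVlt => /predU1P[<-//|].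
have := generic_le_typical typ1.
case: r => // r gr1 r1r rr2; apply: contrapT => atyp.
have [||M] := @atypical_closure r (r2 - r.+1) M2 _ _ atyp _ M2r.
- by rewrite -ltnS (leq_ltn_trans gr1).
- by rewrite subnKC // /rk (nbhs_singleton M2r).
- by rewrite /= /rk => ->; rewrite leqNgt rr2.
Qed.

End TypicalRanks.
End CompletionRank.

Theorem proposition2p8 (R : realType) (m n : nat) (E : {set 'I_m * 'I_n}) :
  (exists2 g : nat,
     unique (generic_completion_rank R E) g
   & typical_completion_rank R E g /\
     forall r : nat, typical_completion_rank R E r -> (g <= r)%N)
  /\
  (forall r1 r2 r : nat,
     (r1 < r2)%N ->
     typical_completion_rank R E r1 -> typical_completion_rank R E r2 ->
     (r1 <= r <= r2)%N -> typical_completion_rank R E r).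
Proof.
have [q q0 qconst] := completion_rank_constant E R[i].
have [v qv] := q0.
have g_gen : generic_completion_rank R E
    (completion_rank (v : partial_matrix R[i] E)).
  by apply/generic_completion_rankP; exists q => // M qM; apply: qconst.
split=> [|r1 r2 r _ t1 t2 r12]; last first.
  exact: (typical_interval g_gen t1 t2 r12).
exists (completion_rank (v : partial_matrix R[i] E)); last first.
  by split; [exact: typical_generic g_gen | exact: (generic_le_typical g_gen)].
split=> // g' /generic_completion_rankP[q' q'0 g'E].
have [w] := nonvanishingM q0 q'0.
rewrite mevalM mulf_eq0 negb_or => /andP[qw /g'E <-].
exact: qconst.
Qed.
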